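(* Let $k$ be a field, let $p<q$ be coprime positive integers, $\mathcal{R}=k[[z^p,z^q]]$, let $r\ge 1$ be an integer (the rank), and let $\widetilde{\Gamma}=r\cdot(\mathbb{Z}_+p+\mathbb{Z}_+q)$. Let $\Delta\subset\mathbb{N}$ be a standard rank-$r$ $\widetilde{\Gamma}$-module with $p$-basis $\{r\,a_{i,j}+i \mid 0\le i\le r-1,\ 0\le j\le p-1\}$. Then the variety $\mathcal{J}_{r}(\Delta)$ of all standard rank-$r$ $\mathcal{R}$-modules $\mathcal{M}$ with $\upsilon(\mathcal{M})=\Delta$ is biregularly isomorphic to the affine space $\mathbb{A}^{\sum_{i=0}^{r-1}N_i}$ over $k$, where $$N_i=\sum_{j=0}^{p-1}\bigl(\gamma_{\Delta}(r\, a_{i,j}+i)-\gamma_{\Delta}(r\, a_{i,j}+i+r q)\bigr).$$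
   Context: Here $\mathbb{N}=\mathbb{Z}_+=\{0,1,2,\dots\}$. Let $\mathcal{O}=k[[z]]$ and $\widetilde{\mathcal{O}}=\mathcal{O}[z^{1/r}]=k[[z^{1/r}]]$, which is a free $\mathcal{O}$-module of rank $r$ with basis $z^{i/r}$, $0\le i\le r-1$ (so it is a realization of $\mathcal{O}^{r}$). The valuation $\upsilon$ on $\widetilde{\mathcal{O}}$ is normalized by $\upsilon(z^{j/r})=j$, i.e. $\upsilon(y)$ is the smallest $j$ such that $z^{j/r}$ occurs in $y\neq 0$. For an $\mathcal{R}$-submodule $\mathcal{M}\subset\widetilde{\mathcal{O}}$, $\upsilon(\mathcal{M})=\{\upsilon(y)\mid 0\ne y\in\mathcal{M}\}$. An $\mathcal{R}$-submodule $\mathcal{M}\subset\widetilde{\mathcal{O}}$ is called standard (of rank $r$) if it generates $\widetilde{\mathcal{O}}$ over $\mathcal{O}$; equivalently, $\{0,1,\dots,r-1\}\subset\upsilon(\mathcal{M})$. A standard rank-$r$ $\widetilde{\Gamma}$-module is a subset $\Delta\subset\mathbb{N}$ with $\Delta+\widetilde{\Gamma}\subset\Delta$ and $\{0,1,\dots,r-1\}\subset\Delta$. For $0\le i\le r-1$ put $\Delta^{(i)}=\{(x-i)/r \mid x\in\Delta,\ x\equiv i \bmod r\}$; it is a module over $\mathbb{Z}_+p+\mathbb{Z}_+q$ containing $0$. There is a unique $p$-tuple $(a_{i,0},\dots,a_{i,p-1})$ with $\Delta^{(i)}=\bigcup_{j=0}^{p-1}(a_{i,j}+p\mathbb{N})$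 and $a_{i,j}\equiv jq \bmod p$. The set $\{r\,a_{i,j}+i\}$ is called the $p$-basis of $\Delta$. The gap counting function is $\gamma_\Delta(b)=|[b,\infty)\setminus\Delta|$, the number of integers $\ge b$ not in $\Delta$. Variety structure: let $c$ be the conductor of $\mathcal{R}$, i.e. the smallest integer with $z^{c}\mathcal{O}\subset\mathcal{R}$. Every standard $\mathcal{M}$ contains $z^c\widetilde{\mathcal{O}}$, so the standard $\mathcal{M}$ with $\upsilon(\mathcal{M})=\Delta$ are identified with the $\mathcal{R}$-invariant $k$-subspaces of $\widetilde{\mathcal{O}}/z^c\widetilde{\mathcal{O}}$ of codimension $|\mathbb{N}\setminus\Delta|$ satisfying the jump conditions prescribed by $\Delta$ (the quotient of the elements of valuation $\ge s$ by those of valuation $\ge s+1$ is one-dimensional for $s\in\Delta$, $s<rc$, and zero for $s\notin\Delta$). This makes $\mathcal{J}_r(\Delta)$ a quasi-projective variety (a locally closed subvariety of a Grassmannian). *)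

(* Defs.v *)
From mathcomp Require Import all_boot all_algebra finmap.
From mathcomp Require Import boolp classical_sets functions cardinality.

Set Implicit Arguments.
Unset Strict Implicit.
Unset Printing Implicit Defensive.

Import GRing.Theory.
Local Open Scope classical_set_scope.
Local Open Scope ring_scope.

(* A formal power series is its coefficient sequence.  A series in
   O = k[[z]] is [g : nat -> k], with [g m] the coefficient of z^m.
   A series in Otilde_A = A[[t]], where t = z^(1/r) and A is a k-algebra, is
   [y : nat -> A], with [y s] the coefficient of t^s; Otilde = k[[t]] is the case
   A = k^o (k as an algebra over itself).                                     *)

Section Series.
Variables (k : fieldType) (p q r : nat).

(* k[[z^p, z^q]]: the image of k[[x, y]] under x |-> z^p, y |-> z^q, where h is
   the array of coefficients in k[[x, y]].  The exponents a and b that contribute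
   to z^m are at most m when 0 < p and 0 < q.                                 *)
Definition ring_R : set (nat -> k) :=
  [set g | exists h : nat -> nat -> k, forall m,
     g m = \sum_(a < m.+1) \sum_(b < m.+1 | (p * a + q * b == m)%N) h a b].

(* c is the smallest integer with z^c O included in k[[z^p, z^q]].            *)
Definition is_conductor (c : nat) : Prop :=
  let contains n :=
    [set g : nat -> k | forall m, (m < n)%N -> g m = 0] `<=` ring_R in
  contains c /\ forall n, contains n -> (c <= n)%N.

(* The product g(t^r) * y(t).                                                 *)
Definition Oact (A : comAlgType k) (g : nat -> k) (y : nat -> A) : nat -> A :=
  fun s => \sum_(m < s.+1 | (r * m <= s)%N) g m *: y (s - r * m)%N.

Definition Rsubmodule (A : comAlgType k) (M : set (nat -> A)) : Prop :=
  [/\ M \0,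
      forall x y, M x -> M y -> M (x \+ y)
    & forall g y, ring_R g -> M y -> M (Oact g y)].

Definition standard (M : set (nat -> k^o)) : Prop :=
  Rsubmodule M /\
  forall y : nat -> k^o, exists n (g : 'I_n -> nat -> k) (x : 'I_n -> nat -> k^o),
    (forall i, M (x i)) /\ forall s, y s = \sum_i Oact (g i) (x i) s.

End Series.

Definition upsilon (k : fieldType) (M : set (nat -> k^o)) : set nat :=
  [set s | exists2 y, M y & y s != 0 /\ forall i, (i < s)%N -> y i = 0].

Section Combinatorics.
Variables (p q r : nat) (Delta : set nat).

Definition standard_semimodule : Prop :=
  (forall x a b, Delta x -> Delta (x + r * (p * a + q * b))%N) /\
  (forall i, (i < r)%N -> Delta i).

Definition Delta_part (i : nat) : set nat :=
  [set ((x - i) %/ r)%N | x in [set x | Delta x /\ x = i %[mod r]]].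

Definition is_pbasis (a : 'I_r -> 'I_p -> nat) : Prop :=
  forall i : 'I_r,
    Delta_part i = \bigcup_(j in [set: 'I_p]) [set (a i j + p * n)%N | n in setT]
    /\ forall j : 'I_p, a i j = (j * q)%N %[mod p].

(* The complement of a standard semimodule is finite when p and q are coprime
   and r is positive, so that the cardinal below is the actual one.           *)
Definition gamma (b : nat) : nat :=
  #|` fset_set ([set x | (b <= x)%N] `\` Delta)|%fset.

(* gamma is nonincreasing, so that the subtraction is never truncated.        *)
Definition dimN (a : 'I_r -> 'I_p -> nat) (i : 'I_r) : nat :=
  (\sum_(j < p) (gamma (r * a i j + i) - gamma (r * a i j + i + r * q)))%N.

End Combinatorics.

(* Varieties over an arbitrary (possibly finite) field k are represented by their
   functors of points on commutative k-algebras: [points X A] is the set of A-points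
   of X and [pull X f] is the base change along f : A -> B.  By Yoneda, morphisms
   of varieties over k are the natural families of maps between their points. *)

Record kfunctor (k : fieldType) := KFunctor {
  ambient : comAlgType k -> Type;
  points : forall A : comAlgType k, set (ambient A);
  pull : forall A B : comAlgType k, {lrmorphism A -> B} -> ambient A -> ambient B
}.

Arguments ambient {k} X A : rename.
Arguments points {k} X A _ : rename.
Arguments pull {k} X {A B} f _ : rename.

Definition is_morphism (k : fieldType) (X Y : kfunctor k)
    (phi : forall A : comAlgType k, ambient X A -> ambient Y A) : Prop :=
  (forall A x, points X A x -> points Y A (phi A x)) /\
  (forall (A B : comAlgType k) (f : {lrmorphism A -> B}) x, points X A x ->
     phi B (pull X f x) = pull Y f (phi A x)).

Definition biregular (k : fieldType) (X Y : kfunctor k) : Prop :=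
  exists (phi : forall A, ambient X A -> ambient Y A)
         (psi : forall A, ambient Y A -> ambient X A),
    [/\ is_morphism phi, is_morphism psi,
        forall A x, points X A x -> psi A (phi A x) = x
      & forall A y, points Y A y -> phi A (psi A y) = y].

Definition affine_space (k : fieldType) (n : nat) : kfunctor k :=
  @KFunctor k (fun A => 'rV[A]_n) (fun A => [set: 'rV[A]_n])
    (fun A B f v => map_mx f v).

(* A submodule of the free module A[[t]] / (t^l) is represented by its preimage in
   A[[t]], that is, by a submodule of A[[t]] containing t^l A[[t]].           *)

Section Grassmannian.
Variables (k : fieldType) (A : comAlgType k).
Implicit Type M : set (nat -> A).

Definition lincomb n (v : 'I_n -> A) (b : 'I_n -> nat -> A) : nat -> A :=
  fun s => \sum_i v i * b i s.

(* The quotient of A[[t]] by M is locally free of rank d: for some g_1, ..., g_m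
   generating the unit ideal of A, its localization at each g_i has a basis of d
   elements.                                                                  *)
Definition locally_free_quotient (d : nat) M : Prop :=
  exists m (g : 'I_m -> A),
    (exists h : 'I_m -> A, \sum_i h i * g i = 1) /\
    forall i, exists b : 'I_d -> nat -> A,
      (forall y, exists e v, M ((g i ^+ e \*o y) \- lincomb v b)) /\
      (forall v, M (lincomb v b) -> exists e, forall j, g i ^+ e * v j = 0).

(* The A-points of the Grassmannian of subspaces of codimension d of
   k[[t]] / (t^l).                                                            *)
Definition grassmannian (l d : nat) : set (set (nat -> A)) :=
  [set M | [/\ M \0,
               forall x y, M x -> M y -> M (x \+ y),
               forall (a : A) x, M x -> M (a \*o x),
               forall y : nat -> A, (forall s, (s < l)%N -> y s = 0) -> M y
             & locally_free_quotient d M]].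

(* The quotient of the elements of M of valuation >= s by those of valuation
   >= s.+1, seen as an ideal of A through the coefficient of t^s.             *)
Definition lead M (s : nat) : set A :=
  [set y s | y in [set y | M y /\ forall i, (i < s)%N -> y i = 0]].

(* Over a general A the one-dimensionality of the quotient at s in Delta reads
   [lead M s = setT]: this is what makes it hold in every fibre.              *)
Definition jumps (l : nat) (Delta : set nat) M : Prop :=
  forall s, (s < l)%N ->
    (Delta s -> lead M s = setT) /\ (~ Delta s -> lead M s = [set 0]).

End Grassmannian.

(* The submodule of B[[t]] / (t^l) generated by the image of M under f : A -> B. *)
Definition base_change (k : fieldType) (l : nat) (A B : comAlgType k)
    (f : {lrmorphism A -> B}) (M : set (nat -> A)) : set (nat -> B) :=
  [set y | exists n (v : 'I_n -> B) (x : 'I_n -> nat -> A),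
     (forall i, M (x i)) /\
     forall s, (s < l)%N -> y s = lincomb v (fun i => f \o x i) s].

(* The variety J_r(Delta), inside the Grassmannian of Otilde / z^c Otilde, where
   z^c = t^(r * c).                                                           *)
Definition jacobian_factor (k : fieldType) (p q r c : nat) (Delta : set nat) :
    kfunctor k :=
  @KFunctor k (fun A => set (nat -> A))
    (fun A => [set M | [/\ grassmannian (r * c) (gamma Delta 0) M,
                           Rsubmodule p q r M & jumps (r * c) Delta M]])
    (fun A B f M => base_change (r * c) f M).

(* Main.v *)
(* Over a k-algebra A, a point M of J_r(Delta) has a unique reduced echelon basis:
   for s in Delta, the row t^s + sum_(u > s, u notin Delta) L(s, u) t^u, so M is the
   graph of the matrix L.  Invariance under multiplication by t^h (h = r p, r q)
   amounts, for s in Delta and u + h notin Delta, to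
     L(s, u) = L(s + h, u + h) + sum_(v < u) L(s, v) L(v + h, u + h),
   where the products only involve entries closer to the diagonal than (s, u).  The
   relations for h = r p express all rows through those of the p-basis.  The
   relations for h = r q then express L(b, u), for b in the p-basis, through the
   entry (b + r q, u + r q) when u + r q is a gap, and leave it free otherwise.
   Iterating u |-> u + r q reaches modulo r p the class of some i < r, which contains
   no gap, so the substitution terminates.  Hence M is determined by arbitrary values
   of L(b, u), for b in the p-basis, u > b a gap and u + r q in Delta; there are
   gamma(b) - gamma(b + r q) such u for every b.  The whole construction is
   given by polynomial formulas, hence is natural in A. *)

Require Import Defs.
From mathcomp Require Import all_boot all_algebra finmap.
From mathcomp Require Import boolp classical_sets functions cardinality.
From mathcomp Require Import zify ring.

Set Implicit Arguments.
Unset Strict Implicit.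
Unset Printing Implicit Defensive.

Import GRing.Theory.
Local Open Scope classical_set_scope.
Local Open Scope ring_scope.

(** * Recursion along a natural-valued measure *)

Section MeasuredRecursion.
Variables (X T : Type) (mu : X -> nat) (Phi : (X -> T) -> X -> T).
Hypothesis Phi_local : forall G G' x,
  (forall y, (mu y < mu x)%N -> G y = G' y) -> Phi G x = Phi G' x.

(** The iterates of [Phi] from a constant stabilize at [x] after more than [mu x] steps, so the
    diagonal value at [(mu x).+1] is a fixpoint. *)
Lemma fixpoint_exists (t0 : T) : exists G, forall x, G x = Phi G x.
Proof.
pose F n := iter n Phi (fun=> t0).
have FE n m x : (mu x < n)%N -> (mu x < m)%N -> F n x = F m x.
  elim: n m x => [//|n IHn] [//|m] x xn xm.
  by apply: Phi_local => y yx; apply: IHn; apply: leq_trans yx _.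
exists (fun x => F (mu x).+1 x) => x; apply: Phi_local => y yx.
exact: FE.
Qed.

Lemma fixpoint_unique G G' :
  (forall x, G x = Phi G x) -> (forall x, G' x = Phi G' x) -> G = G'.
Proof.
move=> GE G'E; apply/funext => x.
have [n] := ubnP (mu x); elim: n x => [//|n IHn] x xn.
by rewrite GE G'E; apply: Phi_local => y yx; apply: IHn; apply: leq_trans yx _.
Qed.

End MeasuredRecursion.

(** * Reduced echelon bases: submodules of A[[t]] as graphs of matrices *)

Section Echelon.
Variables (k : fieldType) (A : comAlgType k) (D : pred nat) (l : nat).
Hypothesis D_tail : forall s, (l <= s)%N -> D s.
Implicit Types (M : set (nat -> A)) (L : nat * nat -> A) (y : nat -> A).

(** Multiplication by t^h. *)
Definition shift (V : zmodType) h (y : nat -> V) : nat -> V :=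
  fun s => if (s < h)%N then 0 else y (s - h)%N.

Definition entry s u := [&& D s, ~~ D u & (s < u)%N].

Definition echelon L := forall s u, ~~ entry s u -> L (s, u) = 0.

(* The row of index s of the reduced echelon basis of [graph L]. *)
Definition ech_row L s : nat -> A := fun j => (j == s)%:R + L (s, j).

(** The coefficients at the gaps are linear functions of those at the pivots, the elements of [D]:
    for an echelon [L] the summands with [j] a gap vanish. *)
Definition graph L : set (nat -> A) :=
  [set y | forall u, ~~ D u -> y u = \sum_(j < u) y j * L (nat_of_ord j, u)].

Definition tail_submodule M :=
  [/\ M \0, forall x y, M x -> M y -> M (x \+ y),
      forall (a : A) x, M x -> M (a \*o x)
    & forall y, (forall s, (s < l)%N -> y s = 0) -> M y].

Definition bjumps M := forall s, (s < l)%N ->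
  (D s -> lead M s = setT) /\ (~~ D s -> lead M s = [set 0]).

Lemma gap_lt u : ~~ D u -> (u < l)%N.
Proof. by move=> Du; rewrite ltnNge; apply: contra Du => /D_tail. Qed.

Lemma tail_submodule_sum M (I : Type) (w : seq I) (P : pred I)
    (v : I -> A) (F : I -> nat -> A) :
  tail_submodule M -> (forall i, P i -> M (F i)) ->
  M (fun s => \sum_(i <- w | P i) v i * F i s).
Proof.
move=> [M0 MD MZ _] MF; elim: w => [|i w IHw].
  by rewrite (_ : (fun=> _) = \0) //; apply/funext => s; rewrite big_nil.
case Pi: (P i); last first.
  by rewrite (_ : (fun=> _) = fun s => \sum_(i <- w | P i) v i * F i s) //;
     apply/funext => s; rewrite big_cons Pi.
rewrite (_ : (fun=> _) = (v i \*o F i) \+ fun s => \sum_(i <- w | P i) v i * F i s).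
  by apply: MD => //; apply: MZ; apply: MF.
by apply/funext => s; rewrite big_cons Pi.
Qed.

Lemma tail_submoduleB M x y : tail_submodule M -> M x -> M y -> M (x \- y).
Proof.
move=> [_ MD MZ _] Mx My.
rewrite (_ : x \- y = x \+ (-1 \*o y)); first by apply: MD => //; apply: MZ.
by apply/funext => s /=; rewrite mulN1r.
Qed.

Lemma tail_submodule_eq M x y : tail_submodule M ->
  (forall s, (s < l)%N -> x s = y s) -> M x -> M y.
Proof.
move=> HM; case: (HM) => [_ MD _ Mt] xy Mx.
rewrite (_ : y = x \+ (y \- x)); last by apply/funext => s /=; rewrite addrC subrK.
by apply: MD => //; apply: Mt => s sl /=; rewrite xy // subrr.
Qed.

Lemma echelon_ge L s u : echelon L -> (u <= s)%N -> L (s, u) = 0.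
Proof. by move=> EL us; rewrite EL // /entry ltnNge us !andbF. Qed.

Lemma echelon_gap L s u : echelon L -> ~~ D s -> L (s, u) = 0.
Proof. by move=> EL Ds; rewrite EL // /entry (negbTE Ds). Qed.

Lemma echelon_pivot L s u : echelon L -> D u -> L (s, u) = 0.
Proof. by move=> EL Du; rewrite EL // /entry Du andbF. Qed.

Lemma ech_rowE L s j : echelon L -> D j -> ech_row L s j = (j == s)%:R.
Proof.
by move=> EL Dj; rewrite /ech_row echelon_pivot ?addr0.
Qed.

Lemma graph_submodule L : tail_submodule (graph L).
Proof.
split=> [u Du|x y Gx Gy u Du|a x Gx u Du|y y0 u Du] /=.
- by rewrite big1 // => j _; rewrite mul0r.
- rewrite Gx // Gy // -big_split /=; apply: eq_bigr => j _; by rewrite mulrDl.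
- by rewrite Gx // mulr_sumr; apply: eq_bigr => j _; rewrite mulrA.
- have ul := gap_lt Du; rewrite y0 // big1 // => j _.
  by rewrite y0 ?mul0r // (ltn_trans (ltn_ord j)).
Qed.

Lemma graph_row L s : echelon L -> D s -> graph L (ech_row L s).
Proof.
move=> EL Ds u Du.
have us : (u == s) = false by apply: contraNF Du => /eqP ->.
rewrite /ech_row us add0r.
have [su|us'] := ltnP s u; last first.
  rewrite echelon_ge // big1 // => j _; have js := leq_trans (ltn_ord j) us'.
  by rewrite (echelon_ge EL (ltnW js)) addr0 (ltn_eqF js) mul0r.
rewrite (bigD1 (Ordinal su)) //= eqxx (@echelon_ge _ s s) // addr0 mul1r.
rewrite big1 ?addr0 // => j js.
have [Dj|Dj] := boolP (D j); last first.
  by rewrite [X in _ * X]echelon_gap ?mulr0.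
rewrite (echelon_pivot _ EL Dj) addr0.
by rewrite -[_ == s]/(j == Ordinal su) (negbTE js) mul0r.
Qed.

(** A row is 1 at its own pivot and 0 at the others, so the coordinates of [y] are its coefficients
    at the pivots. Finitely many rows suffice below [l]. *)
Lemma graph_expand L y : echelon L -> graph L y ->
  forall j, (j < l)%N -> y j = \sum_(s < l | D s) y s * ech_row L s j.
Proof.
move=> EL Gy j jl; have [Dj|Dj] := boolP (D j).
  rewrite (bigD1 (Ordinal jl)) //= ech_rowE // eqxx mulr1 big1 ?addr0 //.
  move=> s /andP[_ sj]; rewrite ech_rowE //.
  by rewrite eq_sym -[_ == j]/(s == Ordinal jl) (negbTE sj) mulr0.
rewrite Gy // (big_ord_widen l (fun s => y s * L (s, j)) (ltnW jl)).
rewrite big_mkcond [RHS]big_mkcond; apply: eq_bigr => s _.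
have [Ds|Ds] := boolP (D s); last by rewrite echelon_gap ?mulr0 ?if_same.
rewrite /ech_row (_ : (j == s) = false) ?add0r; last first.
  by apply: contraNF Dj => /eqP ->.
by case: ltnP => // js; rewrite echelon_ge ?mulr0.
Qed.

(** The row [s] of [L] lies in [graph L'], where its gap coefficients are forced by its pivot
    coefficients, and these are those of the row [s] of [L']. *)
Lemma graph_sub_inj L L' : echelon L -> echelon L' ->
  graph L `<=` graph L' -> L = L'.
Proof.
move=> EL EL' LL'; apply/funext => -[s u].
have [/and3P[Ds Du su]|nsu] := boolP (entry s u); last by rewrite EL ?EL'.
have us : (u == s) = false by rewrite gtn_eqF.
have := LL' _ (graph_row EL Ds) u Du.
rewrite {1}/ech_row us add0r => ->.
rewrite (bigD1 (Ordinal su)) //= ech_rowE // eqxx mul1r.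
rewrite big1 ?addr0 // => j js.
have [Dj|Dj] := boolP (D j); last first.
  by rewrite [X in _ * X]echelon_gap ?mulr0.
by rewrite ech_rowE // -[_ == s]/(j == Ordinal su) (negbTE js) mul0r.
Qed.

Lemma graph_jumps L : echelon L -> bjumps (graph L).
Proof.
move=> EL s sl; split=> Ds; apply/seteqP; split=> // a.
- move=> _; exists (a \*o ech_row L s); last first.
    by rewrite /= ech_rowE // eqxx mulr1.
  split; first by case: (graph_submodule L) => _ _ + _; apply; apply: graph_row.
  move=> i si /=; by rewrite /ech_row (ltn_eqF si) echelon_ge ?addr0 ?mulr0 // ltnW.
- move=> [y [Gy y0] <-] /=; rewrite Gy // big1 // => j _.
  by rewrite y0 ?mul0r.
- move=> ->; exists \0 => //; split=> //; by case: (graph_submodule L).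
Qed.

Lemma jumps_row M s : tail_submodule M -> bjumps M -> D s ->
  exists y, M y /\ (forall j, D j || (j < s)%N -> y j = (j == s)%:R).
Proof.
move=> HM JM Ds; have [M0 MD MZ Mt] := HM.
have lead1 i : D i -> exists y, [/\ M y, y i = 1 & forall j, (j < i)%N -> y j = 0].
  move=> Di; have [il|li] := ltnP i l.
    have /seteqP[_ /(_ 1 I)[y [My y0] y1]] := (JM i il).1 Di.
    by exists y.
  exists (fun j => (j == i)%:R); split; rewrite ?eqxx //.
    by apply: Mt => j jl; rewrite ltn_eqF // (leq_trans jl).
  by move=> j ji; rewrite ltn_eqF.
(* The cut-off descends from [l]. When it reaches a pivot [i], the multiple of an element with
   leading term t^i matching [y i] is split off, and the rest is left to induction. *)
have reduce n y : M y -> exists z, [/\ M z, forall j, (j < l - n)%N -> z j = 0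
    & forall j, D j -> (l - n <= j)%N -> z j = y j].
  elim: n y => [|n IHn] y My.
    exists (fun j => if (j < l)%N then 0 else y j); rewrite subn0; split.
    - by apply: Mt => j ->.
    - by move=> j ->.
    - by move=> j _; rewrite ltnNge => ->.
  have [nl|ln] := ltnP n l; last first.
    have [z [Mz z0 zE]] := IHn y My; exists z.
    by rewrite (_ : (l - n.+1 = l - n)%N) //; lia.
  set i := (l - n.+1)%N; have iE : (l - n = i.+1)%N by rewrite /i; lia.
  have [Di|Di] := boolP (D i); last first.
    have [z [Mz z0 zE]] := IHn y My; exists z; split=> // j.
      by move=> ji; apply: z0; rewrite iE ltnS ltnW.
    move=> Dj ij; apply: zE => //; rewrite iE ltn_neqAle ij andbT.
    by apply: contraNneq Di => ->.
  have [w [Mw w1 w0]] := lead1 i Di.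
  have [z [Mz z0 zE]] := IHn _ (tail_submoduleB HM My (MZ (y i) _ Mw)).
  exists (z \+ (y i \*o w)); split.
  - by apply: MD => //; apply: MZ.
  - by move=> j ji /=; rewrite w0 // mulr0 addr0 z0 // iE ltnS ltnW.
  - move=> j Dj; rewrite leq_eqVlt => /predU1P[<-|ij] /=.
      by rewrite w1 mulr1 z0 ?add0r // iE.
    by rewrite zE ?iE //= subrK.
have [y [My y1 y0]] := lead1 s Ds.
have [z [Mz z0 zE]] := reduce (l - s.+1)%N y My.
have [sl|ls] := ltnP s l; last first.
  exists (fun j => (j == s)%:R); split=> //; apply: Mt => j jl.
  by rewrite ltn_eqF // (leq_trans jl).
have sE : (l - (l - s.+1) = s.+1)%N by rewrite subKn.
rewrite sE in z0 zE.
(* Here [z] vanishes up to [s] and agrees with [y] at all later pivots, so subtracting it clears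
   these. *)
exists (y \- z); split; first exact: tail_submoduleB.
move=> j /=; have [js _|sj|->] := ltngtP j s.
- by rewrite y0 // z0 ?subrr // ltnS ltnW.
- by rewrite orbF => Dj; rewrite zE // subrr.
- by rewrite y1 z0 // subr0.
Qed.

Lemma graph_exists M : tail_submodule M -> bjumps M ->
  exists2 L, echelon L & M = graph L.
Proof.
move=> HM JM; have [M0 MD MZ Mt] := HM.
have /choice[e eP] : forall s, exists y, D s ->
    M y /\ (forall j, D j || (j < s)%N -> y j = (j == s)%:R).
  move=> s; have [Ds|Ds] := boolP (D s); last by exists \0.
  by have [y yP] := jumps_row HM JM Ds; exists y.
pose L x := if entry x.1 x.2 then e x.1 x.2 else 0.
have EL : echelon L by move=> s u /negbTE /= nsu; rewrite /L /= nsu.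
have rowE s : D s -> ech_row L s = e s.
  move=> Ds; have [_ es] := eP s Ds; apply/funext => j; rewrite /ech_row /L /=.
  case: ifP => [/and3P[_ Dj sj]|]; first by rewrite gtn_eqF // add0r.
  rewrite /entry Ds /= => jP; rewrite es ?addr0 //.
  case: (boolP (D j)) jP => //= Dj /negbT; rewrite -leqNgt leq_eqVlt.
  by case/predU1P => // js; rewrite js Ds in Dj.
have HG := graph_submodule L.
exists L => //; apply/seteqP; split=> y yP; last first.
  apply: (@tail_submodule_eq _ (fun j => \sum_(s < l | D s) y s * ech_row L s j)) => //.
    by move=> j jl; rewrite -graph_expand.
  apply: tail_submodule_sum => // s Ds; rewrite rowE //; exact: (eP s Ds).1.
pose z := fun j => \sum_(s < l | D s) y s * ech_row L s j.
have Gz : graph L z by apply: tail_submodule_sum => // s Ds; apply: graph_row.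
apply: tail_submodule_eq Gz => //.
have Mz : M z.
  by apply: tail_submodule_sum => // s Ds; rewrite rowE //; exact: (eP s Ds).1.
have Myz := tail_submoduleB HM yP Mz.
(* The difference of [y] and [z] lies in [M] and vanishes at the pivots. If its first nonzero
   coefficient were at a gap below [l], it would contradict [lead M j = [set 0]]. *)
elim/ltn_ind => j IHj jl.
have [Dj|Dj] := boolP (D j).
  rewrite /z (bigD1 (Ordinal jl)) //= ech_rowE // eqxx mulr1 big1 ?addr0 //.
  move=> s /andP[_ sj]; rewrite ech_rowE //.
  by rewrite eq_sym -[_ == j]/(s == Ordinal jl) (negbTE sj) mulr0.
apply/esym/subr0_eq.
have /seteqP[H _] := (JM j jl).2 Dj; apply: H; exists (y \- z) => //.
split=> // i ij; rewrite /= IHj ?subrr //; exact: ltn_trans jl.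
Qed.

(** The relation is the graph equation for t^h times the row [s], read at t^(u+h). The pivot of the
    row contributes [L (s + h, u + h)]; at gaps below [h] both sides are 0. *)
Lemma graph_shift_row L h s : echelon L -> D s -> D (s + h) ->
  graph L (shift h (ech_row L s)) <->
  (forall u, ~~ D (u + h) -> L (s, u) =
     L (s + h, u + h)%N + \sum_(v < u) L (s, nat_of_ord v) * L (v + h, u + h)%N).
Proof.
move=> EL Ds Dsh.
have expand u : ~~ D (u + h) ->
    \sum_(j < u + h) shift h (ech_row L s) j * L (nat_of_ord j, u + h)%N =
    L (s + h, u + h)%N + \sum_(v < u) L (s, nat_of_ord v) * L (v + h, u + h)%N.
  move=> Du; rewrite addnC big_split_ord /= big1 ?add0r; last first.
    by move=> j _; rewrite /shift ltn_ord mul0r.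
  under eq_bigr => v _.
    rewrite /shift ltnNge leq_addr /= addKn /ech_row mulrDl [(h + v)%N]addnC
            [(h + u)%N]addnC.
    over.
  rewrite big_split /= [(h + u)%N]addnC; congr (_ + _).
  have [su|us] := ltnP s u.
    rewrite (bigD1 (Ordinal su)) //= eqxx mul1r big1 ?addr0 // => j js.
    by rewrite -[_ == s]/(j == Ordinal su) (negbTE js) mul0r.
  rewrite echelon_ge ?leq_add2r // big1 // => j _.
  by rewrite (ltn_eqF (leq_trans (ltn_ord j) us)) mul0r.
have valE u : ~~ D (u + h) -> shift h (ech_row L s) (u + h)%N = L (s, u).
  move=> Du; rewrite /shift ltnNge leq_addl /= addnK /ech_row.
  by rewrite (_ : (u == s) = false) ?add0r //; apply: contraNF Du => /eqP ->.
split=> [G u Du|R u Du].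
  by rewrite -expand // -G // valE.
have [uh|hu] := ltnP u h.
  rewrite {1}/shift uh big1 // => j _.
  by rewrite /shift (ltn_trans _ uh) // mul0r.
by rewrite -(subnK hu) in Du *; rewrite expand // valE // R.
Qed.

Lemma graph_shift L h : echelon L -> (forall s, D s -> D (s + h)) ->
  (forall s, D s -> graph L (shift h (ech_row L s))) ->
  forall y, graph L y -> graph L (shift h y).
Proof.
move=> EL Dh Grow y Gy.
have HG := graph_submodule L.
pose w j := \sum_(s < l | D s) y s * shift h (ech_row L s) j.
have Gw : graph L w by apply: tail_submodule_sum => // s; apply: Grow.
apply: tail_submodule_eq Gw => // j jl; rewrite /w /shift.
case: ifP => jh; first by rewrite big1 // => s _; rewrite mulr0.
by rewrite -graph_expand //; lia.
Qed.

Definition gap_enum := [seq u <- iota 0 l | ~~ D u].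

Lemma mem_gap_enum u : (u \in gap_enum) = ~~ D u.
Proof.
rewrite mem_filter mem_iota /= add0n.
by have [//|Du] := boolP (D u); rewrite gap_lt.
Qed.

(** The monomials at the gaps are a basis of the quotient over all of A, so the trivial covering by
    [g = 1] works. *)
Lemma graph_locally_free L : echelon L ->
  locally_free_quotient (size gap_enum) (graph L).
Proof.
move=> EL; pose gap (i : 'I_(size gap_enum)) := nth 0%N gap_enum i.
have Dgap i : ~~ D (gap i) by rewrite -mem_gap_enum mem_nth.
have gap_inj i j : (gap i == gap j) = (i == j).
  by rewrite nth_uniq // filter_uniq // iota_uniq.
have gap_ex u : ~~ D u -> exists i, gap i = u.
  rewrite -mem_gap_enum => uP.
  have iP : (index u gap_enum < size gap_enum)%N by rewrite index_mem.
  by exists (Ordinal iP); rewrite /gap nth_index.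
pose b (i : 'I_(size gap_enum)) (s : nat) : A := (s == gap i)%:R.
have combD v s : D s -> lincomb v b s = 0.
  move=> Ds; rewrite /lincomb big1 // => i _; rewrite /b.
  case: eqP => [sE|]; last by rewrite mulr0.
  by have := Dgap i; rewrite -sE Ds.
have comb_gap v i : lincomb v b (gap i) = v i.
  rewrite /lincomb (bigD1 i) //= {1}/b eqxx mulr1 big1 ?addr0 // => j ji.
  by rewrite /b gap_inj eq_sym (negbTE ji) mulr0.
exists 1%N, (fun=> 1); split.
  by exists (fun=> 1); rewrite big_ord1 mulr1.
move=> _; exists b; split=> [y|v Gv].
  (* The coordinates measure the failure of [y] to satisfy the graph equations. *)
  exists 0%N, (fun i => y (gap i) - \sum_(j < gap i) y j * L (nat_of_ord j, gap i)).
  rewrite expr0 => u Du; have [i <-] := gap_ex u Du.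
  rewrite /= comb_gap mul1r opprB addrC subrK; apply: eq_bigr => j _.
  have [Dj|Dj] := boolP (D j); first by rewrite combD // subr0 mul1r.
  by rewrite echelon_gap ?mulr0.
exists 0%N => i; rewrite expr0 mul1r -comb_gap Gv // big1 // => j _.
have [Dj|Dj] := boolP (D j); first by rewrite combD // mul0r.
by rewrite echelon_gap ?mulr0.
Qed.

End Echelon.

(** The image under [f] of a row of [L] is the corresponding row of [f \o L], and these rows
    generate the target modulo t^l. *)
Lemma graph_base_change (k : fieldType) (A B : comAlgType k)
    (f : {lrmorphism A -> B}) (D : pred nat) (l : nat) (L : nat * nat -> A) :
  (forall s, (l <= s)%N -> D s) -> echelon D L ->
  base_change l f (graph D L) = graph D (f \o L).
Proof.
move=> Dl EL.
have EfL : echelon D (f \o L) by move=> s u su; rewrite /= EL ?rmorph0.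
have HG : tail_submodule l (graph D (f \o L)) by apply: graph_submodule.
have fG y : graph D L y -> graph D (f \o L) (f \o y).
  move=> Gy u Du /=; rewrite Gy // rmorph_sum; apply: eq_bigr => j _.
  by rewrite rmorphM.
apply/seteqP; split=> y.
  move=> [n [v [x [Gx yE]]]].
  have Gw : graph D (f \o L) (lincomb v (fun i => f \o x i)).
    by apply: (tail_submodule_sum _ _ HG) => i _; apply: fG.
  by apply: (tail_submodule_eq HG) Gw => s sl; rewrite yE.
move=> Gy; exists l, (fun s => y (nat_of_ord s)).
exists (fun s => if D s then ech_row L s else \0); split.
  move=> s; case: ifP => Ds; first exact: graph_row.
  by case: (graph_submodule Dl L).
move=> s sl; rewrite (graph_expand EfL Gy sl) /lincomb big_mkcond.
apply: eq_bigr => j _ /=; case: ifP => Dj /=; last by rewrite rmorph0 mulr0.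
by rewrite /ech_row rmorphD rmorph_nat.
Qed.

(** * The triangular system defining the stable matrices *)

Section Parametrization.
Variables (p q r : nat) (D : pred nat) (l : nat).
Hypotheses (p_gt0 : (0 < p)%N) (q_gt0 : (0 < q)%N) (r_gt0 : (0 < r)%N).
Hypothesis co_pq : coprime p q.
Hypothesis D_tail : forall s, (l <= s)%N -> D s.
Hypothesis Dp : forall s, D s -> D (s + r * p)%N.
Hypothesis Dq : forall s, D s -> D (s + r * q)%N.
Hypothesis D_std : forall i, (i < r)%N -> D i.

(** An intrinsic form of the p-basis; [mem_pbasis_enum] identifies it with the numbers r a_{i,j} +
    i. *)
Definition xbasis s := D s && ~~ ((r * p <= s)%N && D (s - r * p)%N).

Definition free_entry s u := [&& entry D s u, xbasis s & D (u + r * q)%N].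

(* The number of steps of length [r * q] taking [u] to the class of some [i < r]
   modulo [r * p], where there is no gap. *)
Definition climb u := find (fun w => (u + w * (r * q)) %% (r * p) < r)%N (iota 0 p).

Lemma climb_lt u : (climb u < p)%N.
Proof.
rewrite -[X in (_ < X)%N](size_iota 0 p) -has_find; apply/hasP.
have [km kn kE _] := egcdnP p q_gt0; rewrite gcdnC (eqP co_pq) in kE.
(* As [km] inverts q modulo p, this [w] represents -n/q, so n + w q is divisible by p and u + w r q
   is congruent to [u %% r] modulo r p. *)
set n := (u %/ r)%N; set w := (km * (n * (p - 1)))%N.
have wq : (p %| n + w %% p * q)%N.
  rewrite /dvdn -modnDmr modnMml modnDmr -/(dvdn _ _).
  rewrite (_ : (n + w * q = (n + n * (p - 1) * kn) * p)%N) ?dvdn_mull //.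
  rewrite /w (_ : (km * _ * q = n * (p - 1) * (km * q))%N); last by ring.
  rewrite kE; nia.
exists (w %% p)%N; first by rewrite mem_iota ltn_pmod.
rewrite {1}(divn_eq u r) -/n.
have /dvdnP[m mE] := wq.
rewrite (_ : (n * r + u %% r + w %% p * (r * q) = m * (r * p) + u %% r)%N); last by nia.
rewrite modnMDl modn_small ?ltn_pmod //.
by rewrite (leq_trans (ltn_pmod u r_gt0)) // leq_pmulr.
Qed.

Lemma climb_period u : climb (u + r * p) = climb u.
Proof.
by apply: eq_find => w; rewrite addnAC -modnDmr modnn addn0.
Qed.

(** A gap needs at least one step, since the class modulo r p of any i < r lies in [D] from i on;
    after one step, one fewer remains. *)
Lemma climb_gap u : ~~ D u -> (climb (u + r * q) < climb u)%N.
Proof.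
move=> Du; have cp := climb_lt u.
have Dr n i : (i < r)%N -> D (i + n * (r * p))%N.
  move=> ir; elim: n => [|n IHn]; first by rewrite addn0 D_std.
  by rewrite mulSn addnCA addnC Dp.
have : has (fun w => (u + w * (r * q)) %% (r * p) < r)%N (iota 0 p).
  by rewrite has_find size_iota.
move=> /(nth_find 0%N); rewrite -/(climb u) nth_iota // add0n.
case cE: (climb u) => [|c]; rewrite cE in cp.
  rewrite mul0n addn0 => ur; move: Du.
  by rewrite (divn_eq u (r * p)) addnC Dr.
rewrite mulSn addnA => cr; rewrite ltnS leqNgt; apply/negP => cl.
have := before_find 0%N cl; rewrite nth_iota ?(ltnW cp) // add0n.
by rewrite cr.
Qed.

Section Coefficients.
Variables (k : fieldType) (A : comAlgType k).
Implicit Types (L : nat * nat -> A) (w : nat * nat -> A).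

Definition quad h L s u := \sum_(v < u) L (s, nat_of_ord v) * L (v + h, u + h)%N.

Definition shift_rel h L s u := L (s, u) = L (s + h, u + h)%N + quad h L s u.

Definition stable_matrix L := [/\ echelon D L,
  forall y, graph D L y -> graph D L (shift (r * p) y)
  & forall y, graph D L y -> graph D L (shift (r * q) y)].

(** During the recursion [L] is arbitrary; this discards its values outside the entries, where
    [solve_rank] need not decrease. *)
Definition restrict L x := if entry D x.1 x.2 then L x else 0.

(* One step of the triangular system in the entries [L (s, u)]: the relation
   saying that [graph D L] is stable under t^(rp) determines the rows outside the
   p-basis, and stability under t^(rq) the entries which are not free. *)
Definition solve_step w L x :=
  let: (s, u) := x in
  if ~~ entry D s u then 0
  else if (r * p <= s)%N && D (s - r * p)%N then
    restrict L (s - r * p, u - r * p)%N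
      - quad (r * p) (restrict L) (s - r * p) (u - r * p)
  else if D (u + r * q)%N then w (s, u)
  else restrict L (s + r * q, u + r * q)%N + quad (r * q) (restrict L) s u.

(* Encodes the lexicographic order on (u - s, climb u, s): for an entry (s, u),
   climb u < p and s < l. *)
Definition solve_rank (x : nat * nat) :=
  ((x.2 - x.1) * (p * (r * q).+1 + l) + (climb x.2 * (r * q).+1 + x.1))%N.

Lemma solve_rank_lt x y : entry D y.1 y.2 -> (y.2 - y.1 < x.2 - x.1)%N ->
  (solve_rank y < solve_rank x)%N.
Proof.
move=> /and3P[_ Dy yy] yx; have yl := gap_lt D_tail Dy.
have cp := climb_lt y.2.
apply: leq_trans (leq_addr _ _).
apply: (@leq_trans ((y.2 - y.1).+1 * (p * (r * q).+1 + l))); last first.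
  by rewrite leq_mul2r yx orbT.
rewrite mulSn [X in (_ < X)%N]addnC /solve_rank ltn_add2l -addnS.
rewrite leq_add ?leq_mul2r ?(ltnW cp) ?orbT //.
exact: leq_trans yy (ltnW yl).
Qed.

(** Quadratic terms lie closer to the diagonal. The step by r p keeps u - s and [climb] and lowers
    s; the step by r q keeps u - s and lowers [climb], whose weight r q + 1 outweighs the increase
    of s. *)
Lemma solve_step_local w L L' x :
  (forall y, (solve_rank y < solve_rank x)%N -> L y = L' y) ->
  solve_step w L x = solve_step w L' x.
Proof.
case: x => s u LL'; rewrite /solve_step.
have [su|//] := boolP (entry D s u).
have restrictE y : (entry D y.1 y.2 -> (solve_rank y < solve_rank (s, u))%N) ->
    restrict L y = restrict L' y.
  by rewrite /restrict; case: ifP => // yE /(_ isT) /LL'.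
have [Ds Du lt_su] := and3P su.
have quadE h s' u' : (u' - s' = u - s)%N -> (s' < u')%N ->
    quad h (restrict L) s' u' = quad h (restrict L') s' u'.
  move=> us lt_us; apply: eq_bigr => -[v vu] _ /=.
  (* A nonzero first factor forces s' < v, which brings the second factor closer to the diagonal
     too. *)
  have [svE|svE] := boolP (entry D s' v); last by rewrite /restrict (negbTE svE) !mul0r.
  have [vuE|vuE] := boolP (entry D (v + h) (u' + h)); last first.
    by rewrite /restrict /= (negbTE vuE) !mulr0.
  have /and3P[_ _ lt_sv] := svE.
  by congr (_ * _); apply: restrictE => /= E; apply: solve_rank_lt => //=; lia.
have rp0 : (0 < r * p)%N by rewrite muln_gt0 r_gt0.
rewrite /=; case: ifP => [/andP[rps Drps]|_].
  rewrite quadE //; [|lia|lia].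
  congr (_ - _); apply: restrictE => _; rewrite /solve_rank /=.
  have <- : climb (u - r * p) = climb u by rewrite -climb_period subnK //; lia.
  by rewrite (_ : (u - r * p - (s - r * p) = u - s)%N); lia.
case: ifP => // Duq; rewrite quadE //.
congr (_ + _); apply: restrictE => _; rewrite /solve_rank /=.
have := climb_gap Du; rewrite subnDr ltn_add2l => cu.
apply: (@leq_trans ((climb (u + r * q)).+1 * (r * q).+1 + s)); first by lia.
by rewrite leq_add2r leq_mul2r cu orbT.
Qed.

Lemma restrict_echelon L : echelon D L -> restrict L = L.
Proof.
move=> EL; apply/funext => -[s u]; rewrite /restrict /=.
by case: ifPn => // /EL.
Qed.

Lemma stable_shift_rel L s u h : echelon D L -> D s -> D (s + h)%N ->
  (forall y, graph D L y -> graph D L (shift h y)) ->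
  ~~ D (u + h)%N -> shift_rel h L s u.
Proof.
move=> EL Ds Dsh Lh; have Gs := graph_row EL Ds.
exact: (graph_shift_row EL Ds Dsh).1 (Lh _ Gs) u.
Qed.

Lemma stable_solve_step L : stable_matrix L -> forall x, L x = solve_step L L x.
Proof.
move=> [EL Lp Lq] [s u]; rewrite /solve_step restrict_echelon //.
have [/and3P[Ds Du su]|/EL //] /= := boolP (entry D s u).
case: ifP => [/andP[rps Ds']|_].
  have [rpu] : (r * p <= u)%N by lia.
  have Dsp := Dp Ds'.
  have := stable_shift_rel EL Ds' Dsp Lp (u := (u - r * p)%N).
  by rewrite /shift_rel !subnK // => -> //; rewrite addrK.
case: ifPn => // Duq; exact: stable_shift_rel EL Ds (Dq Ds) Lq Duq.
Qed.

Lemma shift_submodule h M : tail_submodule l M ->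
  tail_submodule (A := A) l [set y | M y /\ M (shift h y)].
Proof.
move=> [M0 MD MZ Mt]; split=> [|x y [Mx Mx'] [My My']|a x [Mx Mx']|y y0] /=; split=> //.
- by rewrite (_ : shift h _ = \0) //; apply/funext => s; rewrite /shift /= if_same.
- exact: MD.
- rewrite (_ : shift h _ = shift h x \+ shift h y); first exact: MD.
  by apply/funext => s; rewrite /shift /=; case: ifP; rewrite ?addr0.
- exact: MZ.
- rewrite (_ : shift h _ = a \*o shift h x); first exact: MZ.
  by apply/funext => s; rewrite /shift /=; case: ifP; rewrite ?mulr0.
- exact: Mt.
- apply: Mt => s sl; rewrite /shift; case: ifP => // _.
  by apply: y0; rewrite (leq_ltn_trans (leq_subr _ _)).
Qed.

Lemma shiftC (V : zmodType) h h' (y : nat -> V) :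
  shift h (shift h' y) = shift h' (shift h y).
Proof.
apply/funext => s; rewrite /shift subnAC.
by do 4?[case: ltnP => //= ?]; exfalso; lia.
Qed.

Lemma solve_step_stable w L : (forall x, L x = solve_step w L x) -> stable_matrix L.
Proof.
move=> LE.
have EL : echelon D L by move=> s u su; rewrite LE /= su.
have rE := restrict_echelon EL.
have quad0 h s u : (u <= s)%N -> quad h L s u = 0.
  move=> us; rewrite /quad big1 // => v _.
  by rewrite (echelon_ge EL) ?mul0r // (leq_trans (ltnW (ltn_ord v))).
(* The relation for r p at [(s, u)] is the equation imposed by [solve_step] at [(s + r p, u + r p)],
   so it holds on every row. *)
have Lp : forall y, graph D L y -> graph D L (shift (r * p) y).
  apply: (graph_shift D_tail EL Dp) => s Ds.
  apply/(graph_shift_row EL Ds (Dp Ds)) => u Du.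
  rewrite -/(quad (r * p) L s u).
  have [us|su] := leqP u s; first by rewrite quad0 // !(echelon_ge EL) ?leq_add2r ?addr0.
  rewrite [X in _ = X + _]LE /= /entry Dp // Du ltn_add2r su /=.
  by rewrite leq_addl !addnK Ds /= rE subrK.
split=> //.
(* The relations for r q only hold on the rows of the p-basis, but these generate
   under t^(rp) enough elements for M' to have the same leading exponents as
   [graph D L], and hence to be equal to it. *)
pose M' := [set y | graph D L y /\ graph D L (shift (r * q) y)].
have HG := graph_submodule D_tail L.
have HM' : tail_submodule l M' by apply: shift_submodule.
have M'p y : M' y -> M' (shift (r * p) y).
  by move=> [Gy Gqy]; split; [apply: Lp | rewrite shiftC; apply: Lp].
have M'row s : xbasis s -> M' (ech_row L s).
  move=> /andP[Ds /negbTE Ds']; split; first exact: graph_row.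
  apply/(graph_shift_row EL Ds (Dq Ds)) => u Du; rewrite -/(quad (r * q) L s u).
  have [us|su] := leqP u s; first by rewrite quad0 // !(echelon_ge EL) ?leq_add2r ?addr0.
  have Du' : ~~ D u by apply: contra Du; apply: Dq.
  by rewrite [LHS]LE /= /entry Ds Du' su /= Ds' (negbTE Du) rE.
have M'lead s : D s -> exists y, [/\ M' y, y s = 1 & forall i, (i < s)%N -> y i = 0].
  elim/ltn_ind: s => s IHs Ds.
  have [bs|] := boolP (xbasis s).
    exists (ech_row L s); split; first exact: M'row.
      by rewrite (ech_rowE _ EL Ds) eqxx.
    by move=> i si; rewrite /ech_row (ltn_eqF si) (echelon_ge EL (ltnW si)) addr0.
  rewrite /xbasis Ds /= negbK => /andP[rps Ds'].
  have rp0 : (0 < r * p)%N by rewrite muln_gt0 r_gt0.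
  have [||y [My y1 y0]] := IHs (s - r * p)%N; [lia|by []|].
  exists (shift (r * p) y); split; first exact: M'p.
    by rewrite /shift ltnNge rps.
  by move=> i si; rewrite /shift; case: ltnP => // irp; rewrite y0 //; lia.
have [|L' EL' M'E] := @graph_exists _ _ _ _ D_tail M' HM'.
  move=> s sl; split=> Ds.
    apply/seteqP; split=> // a _.
    have [y [My y1 y0]] := M'lead s Ds; exists (a \*o y); last by rewrite /= y1 mulr1.
    by split; [case: HM' => _ _ + _; apply | move=> i si /=; rewrite y0 ?mulr0].
  apply/seteqP; split=> a.
    move=> [y [[Gy _] y0] <-].
    by have /seteqP[+ _] := (graph_jumps D_tail EL sl).2 Ds; apply; exists y.
  by move=> ->; exists \0 => //; split=> //; case: HM'.
have LL' : L' = L by apply: (graph_sub_inj EL' EL); rewrite -M'E => y [].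
by move=> y Gy; have [] : M' y by rewrite M'E LL'.
Qed.

Lemma stable_matrix_exists w : exists2 L, stable_matrix L &
  forall s u, free_entry s u -> L (s, u) = w (s, u).
Proof.
have [L LE] := fixpoint_exists (@solve_step_local w) 0.
exists L; first exact: solve_step_stable LE.
by move=> s u /and3P[su /andP[_ /negbTE bs] Du]; rewrite LE /= su /= bs Du.
Qed.

(** [solve_step] reads its parameters at free entries only, so both matrices are fixpoints of the
    step with parameters [L]. *)
Lemma stable_matrix_unique L L' : stable_matrix L -> stable_matrix L' ->
  (forall s u, free_entry s u -> L (s, u) = L' (s, u)) -> L = L'.
Proof.
move=> SL SL' LL'; apply: (fixpoint_unique (@solve_step_local L)).
  exact: stable_solve_step.
move=> [s u]; rewrite (stable_solve_step SL') /=.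
have [su|//] := boolP (entry D s u); rewrite /=.
have [//|bs] := boolP (_ && _); case: ifP => // Du.
by rewrite LL' // /free_entry su Du /xbasis bs; case/and3P: su => ->.
Qed.

End Coefficients.

(** The step is polynomial, hence commutes with [f]: [f \o L] solves the system with parameters
    [f \o L]. *)
Lemma stable_matrix_map (k : fieldType) (A B : comAlgType k)
    (f : {lrmorphism A -> B}) (L : nat * nat -> A) :
  stable_matrix L -> stable_matrix (f \o L).
Proof.
move=> SL; apply: (@solve_step_stable _ _ (f \o L)) => -[s u].
have fr x : restrict (f \o L) x = f (restrict L x).
  by rewrite /restrict /=; case: ifP; rewrite ?rmorph0.
have fq h s' u' : quad h (restrict (f \o L)) s' u' = f (quad h (restrict L) s' u').
  by rewrite /quad rmorph_sum; apply: eq_bigr => v _; rewrite !fr rmorphM.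
rewrite /= {1}(stable_solve_step SL) /= !fr !fq.
by do 3?case: ifP => _; rewrite ?rmorph0 ?rmorphB ?rmorphD.
Qed.

End Parametrization.

(** * Invariance under k[[z^p, z^q]] as stability under two shifts *)

Section RingAction.
Variables (k : fieldType) (p q r : nat).
Hypotheses (p_gt0 : (0 < p)%N) (q_gt0 : (0 < q)%N) (r_gt0 : (0 < r)%N).

Lemma ring_R_monomial (e : k) a b :
  ring_R p q (fun m => if m == (p * a + q * b)%N then e else 0).
Proof.
exists (fun a' b' => if (a' == a) && (b' == b) then e else 0) => m.
case: eqP => [mE|mE]; last first.
  rewrite big1 // => a' _; rewrite big1 // => b' /eqP abE.
  by case: ifP => // /andP[/eqP aE /eqP bE]; case: mE; rewrite -abE aE bE.
have am : (a < m.+1)%N by nia.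
have bm : (b < m.+1)%N by nia.
rewrite (bigD1 (Ordinal am)) //= (bigD1 (Ordinal bm)) /=; last by rewrite -mE.
rewrite !eqxx big1 ?addr0; last first.
  move=> b' /andP[_]; rewrite -[_ == b]/(b' == Ordinal bm) => /negbTE ->.
  by rewrite andbF.
rewrite big1 ?addr0 // => a'; rewrite -[_ == a]/(a' == Ordinal am) => /negbTE ->.
by rewrite big1.
Qed.

Lemma Oact_monomial (A : comAlgType k) (e : k) n (y : nat -> A) :
  Oact r (fun m => if m == n then e else 0) y = shift (r * n) (e \*: y).
Proof.
apply/funext => s; rewrite /Oact /shift; case: ltnP => sn.
  rewrite big1 // => m rms; case: eqP => [mn|_]; last by rewrite scale0r.
  by move: rms; rewrite mn leqNgt sn.
have ns : (n < s.+1)%N by nia.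
rewrite (bigD1 (Ordinal ns)) //= eqxx big1 ?addr0 // => m /andP[_].
by rewrite -[_ == n]/(m == Ordinal ns) => /negbTE ->; rewrite scale0r.
Qed.

Lemma Rsubmodule_shift (A : comAlgType k) (M : set (nat -> A)) (e : k) a b y :
  Rsubmodule p q r M -> M y -> M (shift (r * (p * a + q * b)) (e \*: y)).
Proof.
by move=> [_ _ MR] My; rewrite -Oact_monomial; apply: MR => //; apply: ring_R_monomial.
Qed.

Lemma Rsubmodule_stable (A : comAlgType k) (M : set (nat -> A)) :
  Rsubmodule p q r M -> (forall y, M y -> M (shift (r * p) y)) /\
    (forall y, M y -> M (shift (r * q) y)).
Proof.
move=> MR; have scale1 (y : nat -> A) : 1 \*: y = y.
  by apply/funext => s /=; rewrite scale1r.
split=> y My.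
  by have := Rsubmodule_shift 1 1 0 MR My; rewrite scale1 muln1 muln0 addn0.
by have := Rsubmodule_shift 1 0 1 MR My; rewrite scale1 muln1 muln0 add0n.
Qed.

(** A summation box independent of [m] allows the sums to be exchanged later. *)
Lemma ring_R_widen (h : nat -> nat -> k) m N : (m < N)%N ->
  \sum_(a < m.+1) \sum_(b < m.+1 | (p * a + q * b == m)%N) h a b =
  \sum_(a < N) \sum_(b < N) if (p * a + q * b == m)%N then h a b else 0.
Proof.
move=> mN; rewrite (big_ord_widen N (fun a =>
  \sum_(b < m.+1 | (p * a + q * b == m)%N) h a b)) //.
rewrite big_mkcond; apply: eq_bigr => a _; rewrite -big_mkcond.
rewrite (big_ord_widen_cond N (fun b => p * a + q * b == m)%N (h a)) //.
case: ifP => am; last first.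
  by rewrite big1 // => b /eqP abE; move/negbT: am; rewrite -leqNgt; nia.
apply: eq_bigl => b; rewrite andb_idr // => /eqP abE; nia.
Qed.

Lemma shiftD (V : zmodType) h h' (y : nat -> V) :
  shift h (shift h' y) = shift (h + h') y.
Proof.
apply/funext => s; rewrite /shift subnDA.
by do 3?[case: ltnP => //= ?]; exfalso; lia.
Qed.

Lemma stable_Rsubmodule (A : comAlgType k) (M : set (nat -> A)) l :
  tail_submodule l M -> (forall y, M y -> M (shift (r * p) y)) ->
  (forall y, M y -> M (shift (r * q) y)) -> Rsubmodule p q r M.
Proof.
move=> HM Mp Mq; have [M0 MD _ _] := HM; split=> // g y [h hE] My.
have Mshift a b : M (shift (r * (p * a + q * b)) y).
  elim: b => [|b IHb].
    elim: a => [|a IHa].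
      rewrite !muln0 (_ : shift 0 y = y) //.
      by apply/funext => s; rewrite /shift subn0.
    rewrite (_ : (_ * _ = r * p + r * (p * a + q * 0))%N); last by ring.
    by rewrite -shiftD; apply: Mp.
  rewrite (_ : (_ * _ = r * q + r * (p * a + q * b))%N); last by ring.
  by rewrite -shiftD; apply: Mq.
(* Modulo t^l only the monomials with [a] and [b] below [l] act, which replaces the series [g] by a
   finite sum. *)
pose z s := \sum_(a < l) 1 * \sum_(b < l) (h a b)%:A * shift (r * (p * a + q * b)) y s.
have Mz : M z.
  pose F (a : 'I_l) s := \sum_(b < l) (h a b)%:A * shift (r * (p * a + q * b)) y s.
  apply: (@tail_submodule_sum _ _ _ _ _ _ _ (fun=> 1) F HM) => a _.
  by apply: (@tail_submodule_sum _ _ _ _ _ _ _ (fun b : 'I_l => (h a b)%:A)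
    (fun b => shift (r * (p * a + q * b)) y) HM).
apply: (tail_submodule_eq HM) Mz => s sl; rewrite /z /Oact.
transitivity (\sum_(a < l) \sum_(b < l) \sum_(m < s.+1 | (r * m <= s)%N)
    (if (p * a + q * b == m)%N then h a b else 0) *: y (s - r * m)%N).
  apply: eq_bigr => a _; rewrite mul1r; apply: eq_bigr => b _.
  rewrite mulr_algl /shift; case: ltnP => [sab|abs].
    rewrite scaler0 big1 // => m rms; case: eqP => [mE|_]; last by rewrite scale0r.
    by move: rms; rewrite -mE leqNgt sab.
  have abs' : (p * a + q * b < s.+1)%N by nia.
  rewrite (bigD1 (Ordinal abs')) //= eqxx big1 ?addr0 // => m /andP[_].
  by rewrite eq_sym -[_ == m :> nat]/(Ordinal abs' == m) => /negbTE ->; rewrite scale0r.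
under eq_bigr => a _ do rewrite exchange_big /=.
rewrite exchange_big /=; apply: eq_bigr => m rms.
rewrite hE (@ring_R_widen h m l); last by rewrite (leq_trans (ltn_ord m)).
by rewrite scaler_suml; apply: eq_bigr => a _; rewrite scaler_suml.
Qed.

End RingAction.

Lemma Oact_widen (k : fieldType) (r N : nat) (A : comAlgType k) (g : nat -> k)
    (y : nat -> A) s : (0 < r)%N -> (s < N)%N ->
  Oact r g y s = \sum_(m < N | (r * m <= s)%N) g m *: y (s - r * m)%N.
Proof.
move=> r_gt0 sN; rewrite /Oact (big_ord_widen_cond N (fun m => r * m <= s)%N
  (fun m => g m *: y (s - r * m)%N)) //.
by apply: eq_bigl => m; rewrite andb_idr // => rms; nia.
Qed.

Lemma Oact_shift (k : fieldType) (r c : nat) (A : comAlgType k) (g : nat -> k)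
    (x : nat -> A) : (0 < r)%N ->
  Oact r (shift c g) x = shift (r * c) (Oact r g x).
Proof.
move=> r_gt0; apply/funext => s.
rewrite (@Oact_widen _ _ (c + s.+1)) ?leq_addl // /shift.
rewrite big_mkcond big_split_ord /= big1 ?add0r; last first.
  by move=> m _; rewrite ltn_ord scale0r if_same.
under eq_bigr => m _ do rewrite ltnNge leq_addr addKn mulnDr subnDA /=.
case: ltnP => [src|rcs].
  by rewrite big1 // => m _; rewrite leqNgt (leq_trans src) ?leq_addr.
rewrite (@Oact_widen _ _ s.+1) ?ltnS ?leq_subr // [RHS]big_mkcond.
by apply: eq_bigr => m _; rewrite leq_subRL.
Qed.

(** * The points of the variety and the standard modules *)

Section Points.
Variables (k : fieldType) (p q r c : nat) (D : pred nat).
Hypotheses (p_gt0 : (0 < p)%N) (q_gt0 : (0 < q)%N) (r_gt0 : (0 < r)%N).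
Hypothesis D_tail : forall s, (r * c <= s)%N -> D s.
Hypothesis D_std : forall i, (i < r)%N -> D i.

Let Delta : set nat := [set s | D s].

Lemma gammaE b :
  gamma Delta b = count (fun x => (b <= x)%N && ~~ D x) (iota 0 (r * c)).
Proof.
pose s := [seq x <- iota 0 (r * c) | (b <= x)%N && ~~ D x].
rewrite /gamma (_ : _ `\` _ = [set` [fset x in s]%fset]); last first.
  apply/seteqP; split=> x /=; rewrite in_fset mem_filter mem_iota.
    move=> [bx /negP Dx]; rewrite bx Dx /= add0n; exact: gap_lt Dx.
  by move=> /andP[/andP[bx Dx] _]; split=> //; apply/negP.
by rewrite set_fsetK card_fseq undup_id ?filter_uniq ?iota_uniq // size_filter.
Qed.

(** The jump conditions yield the echelon form, and invariance under the ring yields the two shifts.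
    Conversely, the rank of the quotient is the number of gaps, [gamma Delta 0]. *)
Lemma points_graph (A : comAlgType k) (M : set (nat -> A)) :
  points (jacobian_factor k p q r c Delta) A M <->
  exists2 L, stable_matrix p q r D L & M = graph D L.
Proof.
split.
  move=> [[M0 MD MZ Mt _] MR MJ].
  have HM : tail_submodule (r * c) M by [].
  have [|L EL ME] := graph_exists D_tail HM.
    by move=> s sl; have [Js Js'] := MJ s sl; split=> // /negP.
  have [Mp Mq] := Rsubmodule_stable p_gt0 q_gt0 r_gt0 MR.
  by exists L => //; split=> // y; rewrite -ME; [apply: Mp | apply: Mq].
move=> [L [EL Lp Lq] ->].
have HG := graph_submodule D_tail L; have [G0 GD GZ Gt] := HG.
split; last by move=> s sl; have [Js Js'] := graph_jumps D_tail EL sl; split=> // /negP.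
  split=> //; rewrite gammaE -size_filter.
  exact: graph_locally_free.
exact: stable_Rsubmodule HG Lp Lq.
Qed.

Lemma graph_upsilon (L : nat * nat -> k^o) :
  echelon D L -> upsilon (graph D L) = Delta.
Proof.
move=> EL; apply/seteqP; split=> s.
  move=> [y Gy [ys y0]]; apply: contraNT ys => Ds.
  have /seteqP[+ _] := (graph_jumps D_tail EL (gap_lt D_tail Ds)).2 Ds.
  by move=> H; apply/eqP; apply: H; exists y.
move=> Ds; exists (ech_row L s); first exact: graph_row.
split; first by rewrite (ech_rowE _ EL Ds) eqxx oner_neq0.
by move=> i si; rewrite /ech_row (ltn_eqF si) (echelon_ge EL (ltnW si)) addr0.
Qed.

(* The coefficients [g i] are obtained by successive approximation: the coefficient
   of t^s in [y] determines the coefficient [s %/ r] of the series [g (s %% r)]. *)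
Lemma graph_generates (L : nat * nat -> k^o) (y : nat -> k^o) : echelon D L ->
  exists g : 'I_r -> nat -> k,
    forall s, y s = \sum_i Oact r (g i) (ech_row L (nat_of_ord i)) s.
Proof.
(* The index [j] encodes the series z^(j %/ r) times the row [j %% r], whose leading exponent is
   [j]. The formula is meaningful for r (j %/ r) <= s, whence the test below. *)
move=> EL; pose row j s : k := ech_row L (j %% r)%N (s - r * (j %/ r))%N.
have rowD j : D (j %% r)%N by rewrite D_std // ltn_pmod.
have row1 s : row s s = 1.
  have -> : row s s = ech_row L (s %% r)%N (s %% r)%N.
    by rewrite /row; congr (ech_row L _ _); have := divn_eq s r; lia.
  by rewrite (ech_rowE _ EL (rowD s)) eqxx.
pose step (G : nat -> k) s := y s - \sum_(j < s) G (nat_of_ord j) * row j s.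
have [|G GE] := @fixpoint_exists nat k id step _ 0.
  move=> G G' s GG'; congr (_ - _); apply: eq_bigr => j _.
  by rewrite GG'.
exists (fun i m => G (m * r + i)%N) => s.
have yE : y s = \sum_(0 <= j < s.+1) G j * row j s.
  by rewrite big_mkord big_ord_recr /= row1 mulr1 [X in _ + X]GE addrC subrK.
rewrite yE {yE}.
(* The range becomes a rectangle indexed by [j %/ r] and [j %% r]; the added terms vanish because a
   row is 0 below its index. *)
transitivity (\sum_(0 <= j < s.+1 * r)
    if (r * (j %/ r) <= s)%N then G j * row j s else 0).
  rewrite [RHS](@big_cat_nat _ _ _ s.+1) ?leq_pmulr //=.
  rewrite [X in _ = _ + X]big_nat_cond [X in _ = _ + X]big1 ?addr0; last first.
    move=> j /andP[/andP[sj _] _]; case: ifP => // rjs.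
    have sjr : (s - r * (j %/ r) < j %% r)%N by have := divn_eq j r; lia.
    rewrite /row /ech_row (ltn_eqF sjr) add0r (echelon_ge EL) ?mulr0 //.
    exact: ltnW.
  rewrite !big_nat; apply: eq_bigr => j /andP[_ js].
  by rewrite (_ : (r * (j %/ r) <= s)%N) //; have := divn_eq j r; lia.
rewrite big_nat_mul big_mkord.
under eq_bigr => m _.
  rewrite -[(m * r)%N]add0n big_addn mulSn addnK big_mkord.
  under eq_bigr => i _.
    rewrite /row [(_ + m * r)%N]addnC divnMDl // divn_small // addn0.
    rewrite modnMDl modn_small //.
  over.
  over.
rewrite exchange_big /=; apply: eq_bigr => i _; rewrite /Oact [RHS]big_mkcond.
by apply: eq_bigr => m _.
Qed.

Lemma standard_points :
  [set g : nat -> k | forall m, (m < c)%N -> g m = 0] `<=` ring_R p q ->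
  points (jacobian_factor k p q r c Delta) k^o =
  [set M : set (nat -> k^o) | standard p q r M /\ upsilon M = Delta].
Proof.
move=> cR; apply/seteqP; split=> M.
  move=> PM; have /points_graph[L [EL _ _] ME] := PM.
  have [_ MR _] := PM; split; last by rewrite ME graph_upsilon.
  split=> // y; have [g gE] := graph_generates y EL.
  exists r, g, (fun i => ech_row L (nat_of_ord i)); split=> // i.
  by rewrite ME; apply: graph_row => //; apply: D_std.
move=> [[MR Mgen] Mu]; have [M0 MD MO] := MR.
have MZ (e : k^o) y : M y -> M (e \*o y).
  move=> My; have := Rsubmodule_shift p_gt0 q_gt0 r_gt0 e 0 0 MR My.
  rewrite !muln0 (_ : shift 0 _ = e \*o y) //.
  by apply/funext => s; rewrite /shift subn0.
(* Divide [y] by z^c, expand over the generators, and move z^c into the coefficients, which then lie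
   in the ring by the choice of the conductor. *)
have Mt (y : nat -> k^o) : (forall s, (s < r * c)%N -> y s = 0) -> M y.
  move=> y0; have [n [g [x [Mx yE]]]] := Mgen (fun s => y (s + r * c)%N).
  have -> : y = fun s => \sum_(i < n) Oact r (shift c (g i)) (x i) s.
    apply/funext => s; under eq_bigr do rewrite Oact_shift //.
    rewrite /shift; case: ltnP => [src|rcs]; first by rewrite big1 ?y0.
    by rewrite -yE subnK.
  have Mz i : M (Oact r (shift c (g i)) (x i)).
    by apply: MO => //; apply: cR => m mc; rewrite /shift mc.
  elim: (index_enum _) => [|i w IHw].
    by rewrite (_ : (fun=> _) = \0) //; apply/funext => s; rewrite big_nil.
  rewrite (_ : (fun=> _) = Oact r (shift c (g i)) (x i) \+
      fun s => \sum_(j <- w) Oact r (shift c (g j)) (x j) s); first exact: MD.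
  by apply/funext => s; rewrite big_cons.
have HM : tail_submodule (r * c) M by [].
have [|L EL ME] := graph_exists D_tail HM.
  move=> s sl; split=> Ds; apply/seteqP; split=> // e.
  - have : upsilon M s by rewrite Mu.
    move=> [y My [ys y0]] _; exists ((e / y s) \*o y); last by rewrite /= divfK.
    by split; [apply: MZ | move=> i si /=; rewrite (y0 _ si) mulr0].
  - move=> [y [My y0] <-]; apply: contraNeq Ds => ys.
    by rewrite -[is_true _]/(Delta s) -Mu; exists y.
  - by move=> ->; exists \0.
have [Mp Mq] := Rsubmodule_stable p_gt0 q_gt0 r_gt0 MR.
apply/points_graph; exists L => //.
by split=> // y; rewrite -ME; [apply: Mp | apply: Mq].
Qed.

End Points.

(** * The biregular isomorphism, with the free entries as coordinates *)

Lemma jacobian_biregular (k : fieldType) (p q r c : nat) (D : pred nat)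
    (F : seq (nat * nat)) :
  (0 < p)%N -> (0 < q)%N -> (0 < r)%N -> coprime p q ->
  (forall s, (r * c <= s)%N -> D s) ->
  (forall s, D s -> D (s + r * p)%N) -> (forall s, D s -> D (s + r * q)%N) ->
  (forall i, (i < r)%N -> D i) ->
  uniq F -> (forall s u, ((s, u) \in F) = free_entry p q r D s u) ->
  biregular (jacobian_factor k p q r c [set s | D s]) (affine_space k (size F)).
Proof.
move=> p0 q0 r0 co Dt Dp Dq D0 uF memF.
have PG (A : comAlgType k) := points_graph p0 q0 r0 Dt (A := A).
have matP (A : comAlgType k) (M : set (nat -> A)) : exists L : nat * nat -> A,
    points (jacobian_factor k p q r c [set s | D s]) A M ->
    stable_matrix p q r D L /\ M = graph D L.
  have [PM|] := pselect (points (jacobian_factor k p q r c [set s | D s]) A M).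
    by have /PG[L SL ->] := PM; exists L.
  by exists (fun=> 0).
pose mat A M := sval (cid (matP A M)).
have mat_graph A L : stable_matrix p q r D L -> mat A (graph D L) = L.
  move=> SL; rewrite /mat; case: cid => L' /= [|[EL' _ _] GL].
    by apply/PG; exists L.
  have [EL _ _] := SL; apply/esym/(graph_sub_inj EL EL'); by rewrite -GL.
pose val (A : comAlgType k) (v : 'rV[A]_(size F)) x : A :=
  \sum_(i < size F) if nth (0, 0)%N F i == x then v 0 i else 0.
have valE A v (i : 'I_(size F)) : val A v (nth (0, 0)%N F i) = v 0 i.
  rewrite /val (bigD1 i) //= eqxx big1 ?addr0 // => j ji.
  by rewrite nth_uniq // -[(j == i :> nat)]/(j == i) (negbTE ji).
pose sol (A : comAlgType k) (v : 'rV[A]_(size F)) : nat * nat -> A :=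
  s2val (cid2 (stable_matrix_exists p0 q0 r0 co Dt Dp Dq D0 (val A v))).
have sol_stable A v : stable_matrix p q r D (sol A v) by rewrite /sol; case: cid2.
have sol_free A v s u : free_entry p q r D s u -> sol A v (s, u) = val A v (s, u).
  by rewrite /sol; case: cid2 => L /= _; apply.
pose phi (A : comAlgType k) (M : set (nat -> A)) : 'rV[A]_(size F) :=
  \row_i mat A M (nth (0, 0)%N F (nat_of_ord i)).
pose psi (A : comAlgType k) (v : 'rV[A]_(size F)) := graph D (sol A v).
(* Uniqueness gives both the naturality of [psi] and the fact that [psi] inverts [phi]. *)
have sol_unique (A : comAlgType k) (L : nat * nat -> A) (v : 'rV[A]_(size F)) :
    stable_matrix p q r D L ->
    (forall i : 'I_(size F), L (nth (0, 0)%N F i) = v 0 i) -> L = sol A v.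
  move=> SL Lv; apply: (stable_matrix_unique p0 q0 r0 co Dt Dp Dq D0) => // s u su.
  rewrite sol_free //; move: su; rewrite -memF => suF.
  have suI : (index (s, u) F < size F)%N by rewrite index_mem.
  by have := Lv (Ordinal suI); rewrite -valE /= nth_index.
have sol_nth (A : comAlgType k) (v : 'rV[A]_(size F)) (i : 'I_(size F)) :
    sol A v (nth (0, 0)%N F i) = v 0 i.
  rewrite -valE; case E: (nth _ _ _) => [s u].
  by apply: sol_free; rewrite -memF -E mem_nth.
have pull_graph (A B : comAlgType k) (f : {lrmorphism A -> B}) (L : nat * nat -> A) :
    stable_matrix p q r D L ->
    base_change (r * c) f (graph D L) = graph D (f \o L).
  by move=> [EL _ _]; apply: (graph_base_change f Dt).
exists phi, psi; split.
- split=> // A B f M /PG[L SL ->].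
  apply/rowP => i; rewrite !mxE mat_graph // [pull _ _ _]pull_graph // mat_graph //.
  exact: (stable_matrix_map p0 q0 r0 co Dt Dp Dq).
- split=> [A v _|A B f v _]; first by apply/PG; exists (sol A v).
  rewrite [RHS]pull_graph //; congr (graph D _); apply/esym/sol_unique.
    exact: (stable_matrix_map p0 q0 r0 co Dt Dp Dq).
  by move=> i; rewrite /= sol_nth mxE.
- move=> A M /PG[L SL ->]; congr (graph D _).
  by apply/esym/sol_unique => // i; rewrite mxE mat_graph.
- by move=> A v _; apply/rowP => i; rewrite mxE mat_graph // sol_nth.
Qed.

(** The monomial z^m lies in the ring, and its coefficient 1 would be an empty sum if [m] were not
    in the semigroup. *)
Lemma conductor_semigroup (k : fieldType) (p q c m : nat) :
  [set g : nat -> k | forall n, (n < c)%N -> g n = 0] `<=` ring_R p q ->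
  (c <= m)%N -> exists a b, m = (p * a + q * b)%N.
Proof.
move=> cR cm; have [|h /(_ m)] := cR (fun n => (n == m)%:R).
  by move=> n nc; rewrite ltn_eqF // (leq_trans nc).
rewrite eqxx -[_%:R]/(1 : k) => hE; apply: contrapT => nab.
have := oner_neq0 k; rewrite hE.
rewrite big1 ?eqxx // => a _; rewrite big1 // => b /eqP mE.
by case: nab; exists a, b.
Qed.

(** * Counting the free entries *)

Section Counting.
Variables (p q r c : nat) (D : pred nat) (a : 'I_r -> 'I_p -> nat).
Hypothesis p_gt0 : (0 < p)%N.
Hypothesis co_pq : coprime p q.
Hypothesis D_tail : forall s, (r * c <= s)%N -> D s.
Hypothesis Dq : forall s, D s -> D (s + r * q)%N.
Hypothesis a_basis : is_pbasis q [set s | D s] a.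

Lemma Delta_partE (i y : nat) : (i < r)%N ->
  Delta_part r [set s | D s] i y <-> D (r * y + i)%N.
Proof.
move=> ir; split=> [[x [Dx /eqP xi] <-]|Dy].
  rewrite (modn_small ir) in xi.
  have xE : x = (r * (x %/ r) + i)%N by rewrite -(eqP xi) mulnC -divn_eq.
  by move: (x %/ r)%N xE Dx => n -> Dx; rewrite addnK mulKn //; lia.
exists (r * y + i)%N; last by rewrite addnK mulKn //; lia.
by split=> //; rewrite mulnC modnMDl.
Qed.

Lemma pbasisP (i : 'I_r) y :
  D (r * y + i)%N <-> exists j n, y = (a i j + p * n)%N.
Proof.
rewrite -Delta_partE // (a_basis i).1; split=> [[j _ [n _ <-]]|[j [n ->]]].
  by exists j, n.
by exists j => //; exists n.
Qed.

Lemma pbasis_mod_inj (i : 'I_r) j j' : a i j = a i j' %[mod p] -> j = j'.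
Proof.
rewrite !(a_basis i).2 => /eqP E; apply/val_inj/eqP.
rewrite -[val j](modn_small (ltn_ord j)) -[val j'](modn_small (ltn_ord j')).
wlog jj : j j' E / (j <= j')%N.
  move=> H; case: (leqP j j') => [|/ltnW] jj; first exact: H.
  by rewrite eq_sym; apply: H => //; rewrite eq_sym.
move: E; rewrite eq_sym eqn_mod_dvd ?leq_mul2r ?jj ?orbT // -mulnBl.
by rewrite Gauss_dvdl // -eqn_mod_dvd // eq_sym.
Qed.

Definition pbasis_enum : seq nat :=
  [seq (r * a i j + nat_of_ord i)%N | i <- enum 'I_r, j <- enum 'I_p].

(** For fixed [i] the [a i j] are distinct modulo p, so each is the least element of its class in
    the i-th part, and r p cannot be subtracted within [D]. *)
Lemma mem_pbasis_enum s : (s \in pbasis_enum) = xbasis p r D s.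
Proof.
have Da i j n : D (r * (a i j + p * n) + i)%N by apply/pbasisP; exists j, n.
apply/allpairsP/idP => [[[i j] [_ _ ->]]|/andP[Ds nDs]] /=.
  apply/andP; split; first by have := Da i j 0%N; rewrite muln0 addn0.
  apply/negP => /andP[rps]; have ir := ltn_ord i.
  have ap : (p <= a i j)%N.
    rewrite leqNgt; apply/negP => apj; nia.
  rewrite (_ : (_ - _ = r * (a i j - p) + i)%N); last by rewrite mulnBr; nia.
  move=> /pbasisP[j' [n apE]].
  have jj : j = j'.
    apply: (@pbasis_mod_inj i); rewrite -(subnK ap) apE -addnA -mulnSr.
    by rewrite -modnDmr modnMr addn0.
  by rewrite -jj in apE; nia.
have r0 : (0 < r)%N.
  case: (posnP r) D_tail nDs Ds => // ->; rewrite mul0n /= => Dall.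
  by rewrite Dall.
pose i := Ordinal (ltn_pmod s r0).
have sE : s = (r * (s %/ r) + i)%N by rewrite mulnC -divn_eq.
have [j [n sr]] : exists j n, (s %/ r = a i j + p * n)%N.
  by apply/pbasisP; rewrite -sE.
exists (i, j); split; rewrite ?mem_enum //=.
case: n sr => [|n] sr; first by rewrite {1}sE sr muln0 addn0.
case/negP: nDs; rewrite {1}sE sr; apply/andP; split; first by nia.
rewrite (_ : (s - r * p = r * (a i j + p * n) + i)%N) ?Da //.
by rewrite {1}sE sr; nia.
Qed.

Lemma pbasis_enum_uniq : uniq pbasis_enum.
Proof.
apply: allpairs_uniq; rewrite ?enum_uniq // => -[i j] [i' j'] _ _ /= E.
have ii : i = i'.
  apply/val_inj => /=; move/(congr1 (modn^~ r)): E.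
  by rewrite ![(r * _)%N]mulnC !modnMDl !modn_small.
rewrite -ii in E *; congr (_, _); apply: (@pbasis_mod_inj i).
move: E => /addIn /eqP; rewrite eqn_mul2l => /orP[/eqP r0|/eqP -> //].
by have := ltn_ord i; lia.
Qed.

Definition free_enum : seq (nat * nat) :=
  [seq (s, u) | s <- pbasis_enum,
                u <- [seq u <- iota 0 (r * c) | free_entry p q r D s u]].

Lemma mem_free_enum s u : ((s, u) \in free_enum) = free_entry p q r D s u.
Proof.
apply/allpairsPdep/idP => [[s' [u' [_ + [-> ->]]]]|su].
  by rewrite mem_filter => /andP[].
exists s, u; split=> //; first by rewrite mem_pbasis_enum; case/and3P: su.
rewrite mem_filter su mem_iota /= add0n.
by case/and3P: su => /and3P[_ + _] _ _; apply: gap_lt.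
Qed.

Lemma free_enum_uniq : uniq free_enum.
Proof.
apply: allpairs_uniq_dep => [|s _|[s u] [s' u'] _ _ [-> ->] //].
  exact: pbasis_enum_uniq.
by rewrite filter_uniq // iota_uniq.
Qed.

(** The gaps from b + r q on are the u + r q with u >= b such that u + r q, hence also u, is a gap.
    Removing these u from the gaps from b on leaves those with u + r q in [D]. *)
Lemma gamma_sub b : xbasis p r D b ->
  (gamma [set s | D s] b - gamma [set s | D s] (b + r * q))%N =
  size [seq u <- iota 0 (r * c) | free_entry p q r D b u].
Proof.
move=> bb; have /andP[Db _] := bb.
set h := (r * q)%N; set l := (r * c)%N; rewrite !(gammaE D_tail) size_filter.
pose P x := (b + h <= x)%N && ~~ D x.
have PE : count P (iota 0 l) =
    count (fun x => [&& (b <= x)%N, ~~ D x & ~~ D (x + h)%N]) (iota 0 l).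
  have low n m : (n + m <= h)%N -> count P (iota n m) = 0%N.
    move=> nm; apply/eqP; rewrite -leqn0 leqNgt -has_count; apply/hasPn => x.
    rewrite mem_iota /P negb_and -ltnNge => /andP[_ xm].
    by rewrite (leq_trans xm) // (leq_trans nm) ?leq_addl.
  have high m : count P (iota l m) = 0%N.
    apply/eqP; rewrite -leqn0 leqNgt -has_count; apply/hasPn => x.
    by rewrite mem_iota /P => /andP[lx _]; rewrite D_tail ?andbF.
  (* The window moves by [h] at no cost, as [P] fails below [h] and from [l] on. *)
  have -> : count P (iota 0 l) = count P (iota h l).
    have := congr1 (count P) (iotaD 0 l h); rewrite addnC iotaD !count_cat.
    by rewrite !add0n (low 0%N h) // high addn0 add0n => <-.
  rewrite -[h]addn0 iotaDl addn0 count_map; apply: eq_count => x /=.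
  rewrite /P /= [(h + x)%N]addnC leq_add2r; congr (_ && _).
  by rewrite andb_idl // => Dxh; apply: contra Dxh; apply: Dq.
rewrite -/P PE -[X in (X - _)%N]size_filter -(count_predC (fun u => D (u + h)%N)).
rewrite !count_filter (_ : count (predI (predC _) _) _ = count
    (fun x => [&& (b <= x)%N, ~~ D x & ~~ D (x + h)%N]) (iota 0 l)); last first.
  by apply: eq_count => u /=; rewrite andbC -andbA.
rewrite addnK; apply: eq_count => u /=.
rewrite /free_entry /entry bb Db /= andbC; congr (_ && _).
rewrite andbC; have [//|Du] := boolP (D u); rewrite ltn_neqAle /=.
by rewrite (_ : b != u) //; apply: contraNneq Du => <-.
Qed.

Lemma size_free_enum : size free_enum = (\sum_(i < r) dimN q [set s | D s] a i)%N.
Proof.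
rewrite size_allpairs_dep sumnE big_map big_allpairs_dep big_enum.
apply: eq_bigr => i _; rewrite /dimN big_enum; apply: eq_bigr => j _.
by rewrite gamma_sub // -mem_pbasis_enum; apply: allpairs_f; rewrite mem_enum.
Qed.

End Counting.

(* The first conjunct identifies the k-points of the variety with the standard
   modules; the second one is the biregular isomorphism. *)
Theorem theorem3p1 (k : fieldType) (p q r c : nat) (Delta : set nat)
    (a : 'I_r -> 'I_p -> nat) :
  (0 < p)%N -> (p < q)%N -> coprime p q -> (0 < r)%N ->
  is_conductor k p q c ->
  standard_semimodule p q r Delta ->
  is_pbasis q Delta a ->
  points (jacobian_factor k p q r c Delta) k^o
    = [set M : set (nat -> k^o) | standard p q r M /\ upsilon M = Delta]
  /\ biregular (jacobian_factor k p q r c Delta)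
       (affine_space k (\sum_(i < r) dimN q Delta a i)%N).
Proof.
move=> p0 pq co r0 [cR _] [Dstep Dstd] a_basis.
pose D s := `[< Delta s >].
have DeltaE : Delta = [set s | D s].
  by apply/seteqP; split=> s /asboolP.
have q0 : (0 < q)%N by apply: leq_ltn_trans pq.
have Dpq s m n : D s -> D (s + r * (p * m + q * n))%N.
  by move=> /asboolP Ds; apply/asboolP; apply: Dstep.
have D0 i : (i < r)%N -> D i by move=> /Dstd /asboolP.
have Dp s : D s -> D (s + r * p)%N.
  by move=> /(Dpq s 1%N 0%N); rewrite muln1 muln0 addn0.
have Dq s : D s -> D (s + r * q)%N.
  by move=> /(Dpq s 0%N 1%N); rewrite muln1 muln0 add0n.
(* The quotient [s %/ r] is at least c, hence in the semigroup, and the remainder is one of the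
   elements 0, ..., r - 1 of [Delta]. *)
have Dt s : (r * c <= s)%N -> D s.
  move=> rcs; have [|m [n sE]] := @conductor_semigroup k p q c (s %/ r) cR.
    by rewrite leq_divRL // mulnC.
  by rewrite (divn_eq s r) addnC mulnC sE; apply/Dpq/D0/ltn_pmod.
rewrite DeltaE in a_basis *; split; first exact: standard_points.
rewrite -(size_free_enum p0 co Dt Dq a_basis).
apply: jacobian_biregular => //; first exact: free_enum_uniq co a_basis.
exact: mem_free_enum.
Qed.
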